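(* Let $k$ be a field of characteristic zero, $\theta\in k$ with $\theta\neq0$, and let $A$ be a unital associative Rota–Baxter $k$-algebra of weight $\theta$ with Rota–Baxter operator $R$. Let $\Omega'_\theta$ be the weight $\theta$ pre-Lie Magnus type recursion and $\chi_\theta:\lambda A[[\lambda]]\to\lambda A[[\lambda]]$ the $\theta$ BCH-recursion map. Then for every $a\in A$ $$\Omega'_\theta(\lambda a)=\chi_\theta\Bigl(-\frac{\log(1-\theta\lambda a)}{\theta}\Bigr),$$ and for every $\alpha\in\lambda A[[\lambda]]$ $$\chi_\theta(\alpha)=\Omega'_\theta\Bigl(\frac{1-\exp(-\theta\alpha)}{\theta}\Bigr).$$
   Context: An associative Rota–Baxter algebra of weight $\theta$ is an associative $k$-algebra $A$ with a $k$-linear map $R:A\to A$ satisfying $R(x)R(y)=R\bigl(R(x)y+xR(y)+\theta xy\bigr)$ for all $x,y\in A$. Put $\widetilde R:=-\theta\,\mathrm{id}-R$. $R$ and $\widetilde R$ are extended $\lambda$-linearly to $A[[\lambda]]$. The associated left pre-Lie product is $x\rhd y:=R(x)y-yR(x)-\theta yx$, extended $\lambda$-bilinearly, and $L_\rhd[x](y):=x\rhd y$. For $x\in\lambda A[[\lambda]]$, $\Omega'_\theta(x)\in\lambda A[[\lambda]]$ is the unique solution of the recursion $\Omega'_\theta(x)=\sum_{m\ge0}\frac{B_m}{m!}L_\rhd[\Omega'_\theta(x)]^m(x)$, where the Bernoulli numbers are given by $\frac{z}{e^z-1}=\sum_{m\ge0}\frac{B_m}{m!}z^m$. The map $\chi_\theta$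 is recursively given, for $\alpha\in\lambda A[[\lambda]]$, by $$\chi_\theta(\alpha)=\alpha+\frac1\theta\,\mathrm{BCH}\bigl(R(\chi_\theta(\alpha)),\widetilde R(\chi_\theta(\alpha))\bigr),$$ where $\mathrm{BCH}(x,y)$ is defined by $\exp(x)\exp(y)=\exp\bigl(x+y+\mathrm{BCH}(x,y)\bigr)$. It is the unique (usually non-linear) bijection of $\lambda A[[\lambda]]$, deforming the identity, with $\exp(-\theta\alpha)=\exp\bigl(R(\chi_\theta(\alpha))\bigr)\exp\bigl(\widetilde R(\chi_\theta(\alpha))\bigr)$ for all $\alpha\in\lambda A[[\lambda]]$. The exponential and logarithm are the usual ones in $A[[\lambda]]$. *)

(* Defs.v *)
From HB Require Import structures.
From mathcomp Require Import all_boot all_algebra.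
From mathcomp Require Import boolp.

Set Implicit Arguments.
Unset Strict Implicit.
Unset Printing Implicit Defensive.

Import GRing.Theory.
Local Open Scope ring_scope.

(* A[[lambda]]: formal power series in a central variable lambda; [f n] is    *)
(* the coefficient of lambda^n. Equality of series is Leibniz equality, so    *)
(* eqType and choiceType structures come from the classical axioms of boolp.  *)
Record fps (A : Type) := Fps { coefs :> nat -> A }.

Lemma fpsP (A : Type) (f g : fps A) : (forall n, f n = g n) <-> f = g.
Proof.
split=> [|-> //]; case: f g => [f] [g] /= e; congr Fps; exact/funext.
Qed.

HB.instance Definition _ (A : Type) := gen_eqMixin (fps A).
HB.instance Definition _ (A : Type) := gen_choiceMixin (fps A).

Definition fps_map (A B : Type) (h : A -> B) (f : fps A) : fps B :=
  Fps (fun n => h (f n)).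

(* The lambda-bilinear extension of a bilinear map. *)
HB.lock Definition fps_bilin (A B : Type) (C : nmodType) (op : A -> B -> C)
    (f : fps A) (g : fps B) : fps C :=
  Fps (fun n => \sum_(i < n.+1) op (f i) (g (n - i)%N)).

Lemma coefs_bilin (A B : Type) (C : nmodType) (op : A -> B -> C)
    (f : fps A) (g : fps B) n :
  fps_bilin op f g n = \sum_(i < n.+1) op (f i) (g (n - i)%N).
Proof. by rewrite fps_bilin.unlock. Qed.

(* The lambda-adic sum of a family [u] with [u m] in lambda^m A[[lambda]]:    *)
(* only the terms m <= n contribute to the coefficient of lambda^n.           *)
HB.lock Definition fps_sum (A : nmodType) (u : nat -> fps A) : fps A :=
  Fps (fun n => \sum_(m < n.+1) u m n).

Lemma coefs_fps_sum (A : nmodType) (u : nat -> fps A) n :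
  fps_sum u n = \sum_(m < n.+1) u m n.
Proof. by rewrite fps_sum.unlock. Qed.

Section FpsZmod.
Context (A : zmodType).
Implicit Types f g h : fps A.

Definition fps_zero : fps A := Fps (fun=> 0).
Definition fps_opp f : fps A := Fps (fun n => - f n).
Definition fps_add f g : fps A := Fps (fun n => f n + g n).

Fact fps_addA : associative fps_add.
Proof. by move=> f g h; apply/fpsP => n; apply: addrA. Qed.
Fact fps_addC : commutative fps_add.
Proof. by move=> f g; apply/fpsP => n; apply: addrC. Qed.
Fact fps_add0 : left_id fps_zero fps_add.
Proof. by move=> f; apply/fpsP => n; apply: add0r. Qed.
Fact fps_addN : left_inverse fps_zero fps_opp fps_add.
Proof. by move=> f; apply/fpsP => n; apply: addNr. Qed.

HB.instance Definition _ :=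
  GRing.isZmodule.Build (fps A) fps_addA fps_addC fps_add0 fps_addN.

Lemma coefs0 n : (0 : fps A) n = 0. Proof. by []. Qed.
Lemma coefsD f g n : (f + g) n = f n + g n. Proof. by []. Qed.
Lemma coefsN f n : (- f) n = - f n. Proof. by []. Qed.
Lemma coefsB f g n : (f - g) n = f n - g n. Proof. by []. Qed.

Lemma coefs_sum (I : Type) (r : seq I) (P : pred I) (F : I -> fps A) n :
  (\sum_(i <- r | P i) F i) n = \sum_(i <- r | P i) F i n.
Proof.
by elim/big_rec2: _ => [|i x y _ <-]; rewrite ?coefs0 ?coefsD.
Qed.

(* a lambda *)
Definition lamS (a : A) : fps A := Fps (fun n => if n == 1%N then a else 0).

(* The ideal lambda A[[lambda]]. *)
Definition in_lamS f : Prop := f 0%N = 0.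

Lemma fps_sumE (u : nat -> fps A) n N :
    (forall m i, (i < m)%N -> u m i = 0) -> (n < N)%N ->
  fps_sum u n = (\sum_(m < N) u m) n.
Proof.
move=> u0 ltnN; rewrite coefs_fps_sum coefs_sum (big_ord_widen N (fun m => u m n)) //.
rewrite big_mkcond; apply: eq_bigr => m _; case: ltnP => //.
by move=> /u0 ->.
Qed.

End FpsZmod.

Section FpsRing.
Context (A : nzRingType).
Implicit Types f g h : fps A.

Definition fps_one : fps A := Fps (fun n => (n == 0%N)%:R).
Definition fps_mul f g : fps A := fps_bilin *%R f g.

Let trunc N f : {poly A} := \poly_(i < N) f i.

Let coefs_trunc N f n : (n < N)%N -> (trunc N f)`_n = f n.
Proof. by move=> ltnN; rewrite coef_poly ltnN. Qed.

Let coefs_mul N f g n : (n < N)%N ->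
  fps_mul f g n = (trunc N f * trunc N g)`_n.
Proof.
move=> ltnN; rewrite coefs_bilin coefM; apply: eq_bigr => i _.
rewrite !coefs_trunc //; first exact: leq_ltn_trans (leq_subr _ _) ltnN.
exact: leq_ltn_trans (leq_ord i) ltnN.
Qed.

Fact fps_mulA : associative fps_mul.
Proof.
move=> f g h; apply/fpsP => n.
have H (f1 f2 : fps A) (p : {poly A}) : (forall i, (i <= n)%N -> f2 i = p`_i) ->
    fps_mul f1 f2 n = (trunc n.+1 f1 * p)`_n.
  move=> e; rewrite coefs_bilin coefM; apply: eq_bigr => i _; rewrite e ?leq_subr //.
  by rewrite coefs_trunc.
have K (f1 f2 : fps A) (p : {poly A}) : (forall i, (i <= n)%N -> f1 i = p`_i) ->
    fps_mul f1 f2 n = (p * trunc n.+1 f2)`_n.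
  move=> e; rewrite coefs_bilin coefM; apply: eq_bigr => i _; rewrite e ?leq_ord //.
  by rewrite coefs_trunc // ltnS leq_subr.
rewrite (H _ _ (trunc n.+1 g * trunc n.+1 h)); last first.
  by move=> i lein; rewrite (@coefs_mul n.+1).
rewrite (K _ _ (trunc n.+1 f * trunc n.+1 g)) ?mulrA // => i lein.
by rewrite (@coefs_mul n.+1).
Qed.

Fact fps_mul1 : left_id fps_one fps_mul.
Proof.
move=> f; apply/fpsP => n; rewrite coefs_bilin big_ord_recl mul1r.
by rewrite subn0 big1 ?addr0 // => i _; rewrite mul0r.
Qed.

Fact fps_mulr1 : right_id fps_one fps_mul.
Proof.
move=> f; apply/fpsP => n; rewrite coefs_bilin big_ord_recr /=.
rewrite subnn mulr1 big1 ?add0r // => i _.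
by rewrite subn_eq0 leqNgt ltn_ord mulr0.
Qed.

Fact fps_mulDl : left_distributive fps_mul +%R.
Proof.
move=> f g h; apply/fpsP => n; rewrite coefsD !coefs_bilin -big_split; apply: eq_bigr => i _.
by rewrite coefsD mulrDl.
Qed.

Fact fps_mulDr : right_distributive fps_mul +%R.
Proof.
move=> f g h; apply/fpsP => n; rewrite coefsD !coefs_bilin -big_split; apply: eq_bigr => i _.
by rewrite coefsD mulrDr.
Qed.

Fact fps_1neq0 : fps_one != 0.
Proof.
by apply/eqP => /fpsP/(_ 0%N)/eqP; rewrite coefs0 /= oner_eq0.
Qed.

HB.instance Definition _ := GRing.Zmodule_isNzRing.Build (fps A)
  fps_mulA fps_mul1 fps_mulr1 fps_mulDl fps_mulDr fps_1neq0.

Lemma coefs1 n : (1 : fps A) n = (n == 0%N)%:R. Proof. by []. Qed.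
Lemma coefsM f g n : (f * g) n = \sum_(i < n.+1) f i * g (n - i)%N.
Proof. exact: coefs_bilin. Qed.

End FpsRing.

Section FpsAlg.
Context (k : fieldType) (A : algType k).
Implicit Types f g h : fps A.

Definition fps_scale (c : k) f : fps A := Fps (fun n => c *: f n).

Fact fps_scaleA c d f : fps_scale c (fps_scale d f) = fps_scale (c * d) f.
Proof. by apply/fpsP => n; apply: scalerA. Qed.
Fact fps_scale1 : left_id 1 fps_scale.
Proof. by move=> f; apply/fpsP => n; apply: scale1r. Qed.
Fact fps_scaleDr : right_distributive fps_scale +%R.
Proof. by move=> c f g; apply/fpsP => n; apply: scalerDr. Qed.
Fact fps_scaleDl f : {morph fps_scale^~ f : c d / c + d}.
Proof. by move=> c d; apply/fpsP => n; apply: scalerDl. Qed.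

HB.instance Definition _ := GRing.Zmodule_isLmodule.Build k (fps A)
  fps_scaleA fps_scale1 fps_scaleDr fps_scaleDl.

Lemma coefsZ c f n : (c *: f) n = c *: f n. Proof. by []. Qed.

Fact fps_scaleAl (c : k) f g : c *: (f * g) = (c *: f) * g.
Proof.
apply/fpsP => n; rewrite coefsZ !coefsM scaler_sumr; apply: eq_bigr => i _.
by rewrite scalerAl.
Qed.

HB.instance Definition _ :=
  GRing.Lmodule_isLalgebra.Build k (fps A) fps_scaleAl.

Fact fps_scaleAr (c : k) f g : c *: (f * g) = f * (c *: g).
Proof.
apply/fpsP => n; rewrite coefsZ !coefsM scaler_sumr; apply: eq_bigr => i _.
by rewrite scalerAr.
Qed.

HB.instance Definition _ :=
  GRing.Lalgebra_isAlgebra.Build k (fps A) fps_scaleAr.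

(* exp f, for f in lambda A[[lambda]] *)
Definition expS f : fps A := fps_sum (fun m => m`!%:R^-1 *: f ^+ m).

(* log f = sum_(m >= 1) (-1)^(m-1) (f - 1)^m / m,                             *)
(* for f in 1 + lambda A[[lambda]]                                            *)
Definition logS f : fps A :=
  fps_sum (fun m => ((-1) ^+ m / m.+1%:R) *: (f - 1) ^+ m.+1).

(* Solves exp x * exp y = exp (x + y + BCH x y), see BCH_spec, BCH_uniq. *)
Definition BCH (x y : fps A) : fps A := logS (expS x * expS y) - x - y.

End FpsAlg.

(* The fixed point of a map raising lambda-adic agreement on                  *)
(* lambda A[[lambda]]: the coefficient of lambda^n is stationary from the     *)
(* (n+1)-st iterate on, see fix_spec, fix_uniq.                               *)
Definition fps_fix (A : zmodType) (F : fps A -> fps A) : fps A :=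
  Fps (fun n => iter n.+1 F 0 n).

(* The first m.+1 Bernoulli numbers, see bernoulli_gf. *)
Fixpoint bernoulli_seq (k : fieldType) (m : nat) : seq k :=
  if m is m'.+1 then
    let s := bernoulli_seq k m' in
    rcons s (- m.+1%:R^-1 * \sum_(j < m) 'C(m.+1, j)%:R * s`_j)
  else [:: 1].
Definition bernoulli (k : fieldType) (m : nat) : k := (bernoulli_seq k m)`_m.

Section RotaBaxter.
Context (k : fieldType) (theta : k) (A : algType k).

Definition rota_baxter (R : A -> A) : Prop :=
  forall x y : A, R x * R y = R (R x * y + x * R y + theta *: (x * y)).

Context (R : A -> A).

Definition RB_tilde (x : A) : A := - theta *: x - R x.

Definition prelie (x y : A) : A := R x * y - y * R x - theta *: (y * x).

(* L_|>[x], on A[[lambda]] *)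
Definition L_prelie (x : fps A) : fps A -> fps A := fps_bilin prelie x.

Definition Omega_rec (x w : fps A) : fps A :=
  fps_sum (fun m => (bernoulli k m / m`!%:R) *: iter m (L_prelie w) x).

(* The unique w in lambda A[[lambda]] with w = Omega_rec x w, see             *)
(* Omega_spec, Omega_uniq.                                                    *)
Definition Omega (x : fps A) : fps A := fps_fix (Omega_rec x).

Definition chi_rec (alpha w : fps A) : fps A :=
  alpha + theta^-1 *: BCH (fps_map R w) (fps_map RB_tilde w).

(* The unique w in lambda A[[lambda]] with w = chi_rec alpha w, see           *)
(* chi_spec, chi_uniq.                                                        *)
Definition chi (alpha : fps A) : fps A := fps_fix (chi_rec alpha).

End RotaBaxter.

(* Main.v *)
Require Import Defs.
From HB Require Import structures.
From mathcomp Require Import all_boot all_algebra.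
From mathcomp Require Import boolp.

Import GRing.Theory.
Local Open Scope ring_scope.

Set Implicit Arguments.
Unset Strict Implicit.
Unset Printing Implicit Defensive.

(* Write R~ for RB_tilde. The operator L_w = L_prelie w is y |-> R(w) y + y R~(w),   *)
(* the sum of two commuting operators, so exp(L_w)(1) = exp(R w) exp(R~ w), while    *)
(* L_w(1) = - theta w. For w = chi(alpha) the first value is exp(- theta alpha), and *)
(* hence x := (1 - exp(- theta alpha)) / theta equals ((e^L_w - 1) / L_w)(w).        *)
(* Inverting this series by the Bernoulli numbers shows that w is the fixed point    *)
(* Omega(x). The statement for lambda a is the case                                  *)
(* alpha = - log(1 - theta lambda a) / theta.                                        *)

(** By uniqueness of the fixed point ([Omega_uniq]), the second claim only requires that w =
    chi(alpha) solve the Magnus recursion for x = (1 - exp(- theta alpha)) / theta. Two facts turn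
    this into a computation: [L_prelieE] exhibits L_w as left multiplication by R(w) plus right
    multiplication by R~(w), and [lrSM] says that a product of scalar power series acts through such
    an operator as a composition. Then [lrS_exp] evaluates exp(L_w)(1), [expS_chi] identifies the
    value with exp(- theta alpha), and [bernoulli_coefsM] inverts (e^z - 1) / z. The first claim
    follows from the second by [expS_logS]. All convergence is lambda-adic: [valS n (f - g)] is
    congruence modulo lambda^n, infinite sums are compared through their truncations, and both
    recursions are fixed points of maps that raise the order of agreement by one. *)

Definition valS (A : zmodType) (n : nat) (f : fps A) :=
  forall i, (i < n)%N -> f i = 0.

(** * The lambda-adic filtration *)

Section OrderZmod.
Context (A : zmodType).
Implicit Types (f g h : fps A) (u : nat -> fps A).

Lemma in_lamSE f : in_lamS f <-> valS 1 f.
Proof. by split=> [f0 [|//] //|]; apply. Qed.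

Lemma valS0 n : valS n (0 : fps A).
Proof. by []. Qed.

Lemma valSW m n f : (m <= n)%N -> valS n f -> valS m f.
Proof. by move=> lemn fn i ltim; apply/fn/(leq_trans ltim). Qed.

Lemma valSD n f g : valS n f -> valS n g -> valS n (f + g).
Proof. by move=> fn gn i ltin; rewrite coefsD fn ?gn ?addr0. Qed.

Lemma valSN n f : valS n f -> valS n (- f).
Proof. by move=> fn i ltin; rewrite coefsN fn ?oppr0. Qed.

Lemma valSB n f g : valS n f -> valS n g -> valS n (f - g).
Proof. by move=> fn gn; apply/valSD/valSN. Qed.

Lemma valSBC n f g : valS n (f - g) -> valS n (g - f).
Proof. by move=> /valSN; rewrite opprB. Qed.

Lemma valS_trans n f g h : valS n (f - g) -> valS n (g - h) -> valS n (f - h).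
Proof. by move=> fg gh; rewrite -(subrKA g f (- h)); apply: valSD. Qed.

Lemma valSB_eq n f g : valS n (f - g) <-> forall i, (i < n)%N -> f i = g i.
Proof.
by split=> fg i /fg; rewrite coefsB => /eqP; [rewrite subr_eq0|rewrite -subr_eq0] => /eqP.
Qed.

Lemma valS_eq f g : (forall n, valS n (f - g)) -> f = g.
Proof. by move=> fg; apply/fpsP => n; apply: (valSB_eq n.+1 f g).1. Qed.

Lemma valS_big n (I : Type) (r : seq I) (P : pred I) (F : I -> fps A) :
  (forall i, P i -> valS n (F i)) -> valS n (\sum_(i <- r | P i) F i).
Proof. by move=> Fn; elim/big_rec: _ => // i f /Fn; apply: valSD. Qed.

Lemma valS_fps_sum u N :
  (forall m, valS m (u m)) -> valS N (fps_sum u - \sum_(m < N) u m).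
Proof.
move=> um; apply/valSB_eq => i ltiN.
by apply: fps_sumE => // m j; apply: um.
Qed.

(** A lambda-adic sum is determined by its partial sums modulo lambda^N; identities between infinite
    sums below are reduced to finite ones in this way. *)
Lemma fps_sum_uniq u f : (forall m, valS m (u m)) ->
  (forall N, valS N (f - \sum_(m < N) u m)) -> f = fps_sum u.
Proof.
move=> um fu; apply: valS_eq => n.
by apply: valS_trans (fu n) _; apply/valSBC/valS_fps_sum.
Qed.

Lemma valS_fps_sum_ge n u : (forall m, valS n (u m)) -> valS n (fps_sum u).
Proof. by move=> un i ltin; rewrite coefs_fps_sum big1 // => m _; apply: un. Qed.

Lemma fps_sum_sub u v : fps_sum u - fps_sum v = fps_sum (fun m => u m - v m).
Proof.
apply/fpsP => n; rewrite coefsB !coefs_fps_sum -sumrB.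
by apply: eq_bigr => m _; rewrite coefsB.
Qed.

Lemma fps_sum_recl u : (forall m, valS m (u m)) ->
  fps_sum u = u 0%N + fps_sum (fun m => u m.+1).
Proof.
move=> um; apply/fpsP => n; rewrite (@fps_sumE _ u n n.+2) //.
by rewrite big_ord_recl !coefsD coefs_fps_sum coefs_sum.
Qed.

End OrderZmod.

(** * Fixed points of lambda-adic contractions *)

Section FixedPoint.
Context (A : zmodType) (F : fps A -> fps A).
Hypothesis F_lam : forall f, valS 1 f -> valS 1 (F f).
Hypothesis F_contr : forall n f g, valS 1 f -> valS 1 g ->
  valS n (f - g) -> valS n.+1 (F f - F g).

Lemma valS_iter_fix n : valS 1 (iter n F 0).
Proof. by elim: n => //= n; apply: F_lam. Qed.

Lemma fps_fix_uniq w : valS 1 w -> F w = w -> w = fps_fix F.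
Proof.
move=> w1 Fw; have wn n : valS n (w - iter n F 0).
  elim: n => // n IHn; rewrite iterS -{1}Fw.
  by apply: F_contr => //; apply: valS_iter_fix.
by apply/fpsP => n; apply: (valSB_eq n.+1 w (iter n.+1 F 0)).1.
Qed.

(** Consecutive iterates agree modulo lambda^m by contraction, so the coefficient of lambda^i no
    longer changes after the iterate from which [fps_fix] reads it. *)
Lemma valS_fps_fix n : valS n (fps_fix F - iter n F 0).
Proof.
have step m : valS m (iter m.+1 F 0 - iter m F 0).
  by elim: m => // m; apply: F_contr (valS_iter_fix m.+1) (valS_iter_fix m).
apply/valSB_eq => i; elim: n => // n IHn; rewrite ltnS leq_eqVlt.
case/predU1P=> [-> //|ltin]; rewrite IHn //.
by apply/esym/(valSB_eq n _ _).1.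
Qed.

Lemma valS1_fps_fix : valS 1 (fps_fix F).
Proof.
by have := valSD (valS_fps_fix (n := 1)) (valS_iter_fix 1); rewrite subrK.
Qed.

Lemma fps_fix_spec : F (fps_fix F) = fps_fix F.
Proof.
apply: valS_eq => n; apply: (@valSW _ _ n.+1) => //.
(* Both sides are compared with iterate n.+1, which is [F] of iterate n. *)
apply: valS_trans (valSBC (valS_fps_fix (n := n.+1))).
apply: F_contr (valS_fps_fix (n := n)); first exact: valS1_fps_fix.
exact: valS_iter_fix.
Qed.

End FixedPoint.

(** Pairs below the diagonal are grouped by m = i + j: this is the truncated Cauchy product. *)
Lemma sum_triangle (V : nmodType) (F : nat -> nat -> V) N :
  \sum_(i < N) \sum_(j < N | (i + j < N)%N) F i j
  = \sum_(m < N) \sum_(i < m.+1) F i (m - i)%N.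
Proof.
under [RHS]eq_bigr => m _.
  rewrite (big_ord_widen_cond N xpredT (fun i => F i (m - i)%N)) //=; over.
rewrite [RHS](exchange_big_dep xpredT) //=; apply: eq_bigr => i _.
have leiN := ltnW (ltn_ord i); transitivity (\sum_(0 <= j < N - i) F i j).
  rewrite (big_nat_widen _ _ N) ?leq_subr // big_mkord.
  by apply: eq_bigl => j; rewrite ltn_subRL.
rewrite -(big_mkord (fun m => i < m.+1)%N (fun m => F i (m - i)%N)).
rewrite [RHS](@big_cat_nat _ _ _ i) //= [X in X + _]big_nat_cond [X in X + _]big1 ?add0r.
  have := big_addn 0 N i (fun m => i < m.+1)%N (fun m => F i (m - i)%N).
  rewrite add0n => ->.
  by apply: eq_big => m; rewrite ?addnK // ltnS leq_addl.
by move=> m /andP[/andP[_ ltmi]]; rewrite ltnS leqNgt ltmi.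
Qed.

(** * Power series in the operator y -> a y + y b *)

Section OrderAlg.
Context (k : fieldType) (A : algType k).
Implicit Types (f g u a b y : fps A).

Lemma valSZ n (c : k) f : valS n f -> valS n (c *: f).
Proof. by move=> fn i ltin; rewrite coefsZ fn ?scaler0. Qed.

Lemma valSM m n f g : valS m f -> valS n g -> valS (m + n) (f * g).
Proof.
move=> fm gn i lti; rewrite coefsM big1 // => j _.
have [/fm ->|lemj] := ltnP j m; first by rewrite mul0r.
rewrite gn ?mulr0 // ltn_subLR; last by rewrite -ltnS.
by apply: leq_trans lti _; rewrite leq_add2r.
Qed.

Lemma valSX n f : valS 1 f -> valS n (f ^+ n).
Proof. by move=> f1; elim: n => // n IHn; rewrite exprS; apply: (@valSM 1). Qed.

(** Without commutativity, the difference telescopes as f^(m+1) (f - g) + (f^(m+1) - g^(m+1)) g, and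
    every further factor contributes one order. *)
Lemma valSX_sub n m f g : valS 1 f -> valS 1 g -> valS n (f - g) ->
  valS (n + m) (f ^+ m.+1 - g ^+ m.+1).
Proof.
move=> f1 g1 fg; elim: m => [|m IHm]; first by rewrite addn0.
rewrite -(subrKA (f ^+ m.+1 * g)) [in X in X - _ + _]exprSr -mulrBr.
rewrite [in X in _ + (_ - X)]exprSr -mulrBl; apply: valSD.
  by rewrite addnC; apply: valSM => //; apply: valSX.
by rewrite addnS -addn1; apply: valSM.
Qed.

(** This covers both operators needed: L_w for a = R(w), b = R~(w), and plain left multiplication
    for b = 0, through which substitution into a series inherits its multiplicativity. *)
Definition lrmul a b y : fps A := a * y + y * b.

Fact lrmul_linear a b : linear (lrmul a b).
Proof.
move=> c y z; rewrite /lrmul mulrDr mulrDl -scalerAr -scalerAl scalerDr.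
by rewrite addrACA.
Qed.
HB.instance Definition _ a b :=
  GRing.isLinear.Build k (fps A) (fps A) _ (lrmul a b) (lrmul_linear a b).

Definition lriter a b m : fps A -> fps A := iter m (lrmul a b).

Fact lriter_linear a b m : linear (lriter a b m).
Proof. by move=> c y z; elim: m => //= m ->; rewrite linearP. Qed.
HB.instance Definition _ a b m :=
  GRing.isLinear.Build k (fps A) (fps A) _ (lriter a b m) (lriter_linear a b m).

Lemma lriterS a b m y : lriter a b m.+1 y = lrmul a b (lriter a b m y).
Proof. by []. Qed.

Lemma lriterD a b m n y : lriter a b (m + n) y = lriter a b m (lriter a b n y).
Proof. exact: iterD. Qed.

Lemma lriter_mull u m y : lriter u 0 m y = u ^+ m * y.
Proof.
elim: m => [|m IHm]; first by rewrite mul1r.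
by rewrite lriterS IHm /lrmul mulr0 addr0 mulrA exprS.
Qed.

Lemma valS_lrmul p n a b y : valS p a -> valS p b -> valS n y ->
  valS (p + n) (lrmul a b y).
Proof.
move=> ap bp yn; apply: valSD; first exact: valSM.
by rewrite addnC; apply: valSM.
Qed.

Lemma valS_lriter m n a b y : valS 1 a -> valS 1 b -> valS n y ->
  valS (m + n) (lriter a b m y).
Proof. by move=> a1 b1 yn; elim: m => // m; apply: (@valS_lrmul 1). Qed.

Lemma valS_lriter0 m a b y : valS 1 a -> valS 1 b -> valS m (lriter a b m y).
Proof. by move=> a1 b1; rewrite -[X in valS X]addn0; apply: valS_lriter. Qed.

(* The power series [c] evaluated at the operator [lrmul a b]. *)
Definition lrS (c : fps k^o) a b y : fps A :=
  fps_sum (fun m => (c m : k) *: lriter a b m y).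

(** Scalar series have coefficients in [k^o], itself a [k]-algebra, so the same definition also
    composes scalar series with each other. *)
Definition compS (c : fps k^o) u : fps A := fps_sum (fun m => (c m : k) *: u ^+ m).

Section Evaluation.
Context (a b : fps A) (a1 : valS 1 a) (b1 : valS 1 b).

Lemma valS_lrS_term (c : fps k^o) y m : valS m ((c m : k) *: lriter a b m y).
Proof. exact/valSZ/valS_lriter0. Qed.

Lemma valS_lrS (c : fps k^o) y N :
  valS N (lrS c a b y - \sum_(m < N) (c m : k) *: lriter a b m y).
Proof. exact/valS_fps_sum/valS_lrS_term. Qed.

(** Applied to exp, this produces (e^z - 1) / z evaluated on the image of y under the operator. *)
Lemma lrS_recl (c : fps k^o) y :
  lrS c a b y = (c 0%N : k) *: y + lrS (Fps (fun m => c m.+1)) a b (lrmul a b y).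
Proof.
rewrite /lrS fps_sum_recl; last exact: valS_lrS_term.
by congr (_ + fps_sum _); apply/funext => m; rewrite /lriter iterSr.
Qed.

Lemma lrSZ (c : fps k^o) d y : lrS c a b (d *: y) = d *: lrS c a b y.
Proof.
apply/fpsP => n; rewrite coefsZ !coefs_fps_sum scaler_sumr.
by apply: eq_bigr => m _; rewrite linearZ_LR !coefsZ !scalerA mulrC.
Qed.

Lemma lrS1 y : lrS (1 : fps k^o) a b y = y.
Proof.
apply/fpsP => n; rewrite coefs_fps_sum big_ord_recl coefsZ scale1r big1 ?addr0 //.
by move=> i _; rewrite coefsZ scale0r.
Qed.

Lemma lrSM (c d : fps k^o) y : lrS (c * d) a b y = lrS c a b (lrS d a b y).
Proof.
apply/esym/fps_sum_uniq => [m|N]; first exact: valS_lrS_term.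
apply: valS_trans (@valS_lrS c _ N) _.
set s := \sum_(j < N) (d j : k) *: lriter a b j y.
have sN : valS N (lrS d a b y - s) by exact: valS_lrS.
(* The inner series is truncated as well; the operators never lower the order, so the error stays in
   order N. *)
apply: (@valS_trans _ _ _ (\sum_(i < N) (c i : k) *: lriter a b i s)).
  rewrite -sumrB; apply: valS_big => i _; rewrite -scalerBr -linearB.
  by apply/valSZ/(@valSW _ _ (i + N)); rewrite ?leq_addl //; apply: valS_lriter.
have -> : \sum_(m < N) ((c * d) m : k) *: lriter a b m y =
    \sum_(i < N) \sum_(j < N | (i + j < N)%N) (c i * d j : k) *: lriter a b (i + j) y.
  rewrite (sum_triangle (fun i j => (c i * d j : k) *: lriter a b (i + j) y)).
  apply: eq_bigr => m _; rewrite coefsM scaler_suml; apply: eq_bigr => i _.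
  by rewrite subnKC // -ltnS.
rewrite -sumrB; apply: valS_big => i _.
have -> : (c i : k) *: lriter a b i s =
    \sum_(j < N) (c i * d j : k) *: lriter a b (i + j) y.
  rewrite linear_sum scaler_sumr; apply: eq_bigr => j _.
  by rewrite linearZ scalerA lriterD.
(* The square and the triangle of indices differ by the pairs with i + j >= N, whose terms have
   order at least N. *)
rewrite (bigID (fun j : 'I_N => i + j < N)%N) /= addrAC subrr add0r.
apply: valS_big => j; rewrite -leqNgt => leN.
exact/valSZ/(valSW leN)/valS_lriter0.
Qed.

End Evaluation.
End OrderAlg.

Lemma subrACA (V : zmodType) (x y z t : V) :
  x - y - (z - t) = (x - z) - (y - t).
Proof. by rewrite opprD addrACA -opprD. Qed.

(** * Substitution into scalar power series *)

Section Composition.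
Context (k : fieldType) (A : algType k).
Implicit Types (f g u a b y : fps A) (c d l : fps k^o).

Lemma coefs0_compS (c : fps k^o) u : compS c u 0%N = (c 0%N : k)%:A.
Proof. by rewrite coefs_fps_sum big_ord1. Qed.

Lemma valS_compS_term (c : fps k^o) u m : valS 1 u -> valS m ((c m : k) *: u ^+ m).
Proof. by move=> u1; apply/valSZ/valSX. Qed.

Lemma valS_compS (c : fps k^o) u N : valS 1 u ->
  valS N (compS c u - \sum_(m < N) (c m : k) *: u ^+ m).
Proof. by move=> u1; apply: valS_fps_sum => m; apply: valS_compS_term. Qed.

Lemma compSE (c : fps k^o) u : compS c u = lrS c u 0 1.
Proof. by congr fps_sum; apply/funext => m; rewrite lriter_mull mulr1. Qed.

Lemma lrS_mull (c : fps k^o) u y : valS 1 u -> lrS c u 0 y = compS c u * y.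
Proof.
move=> u1; apply/esym/fps_sum_uniq => [m|N].
  by apply/valSZ/valS_lriter0 => //; apply: valS0.
have -> : \sum_(m < N) (c m : k) *: lriter u 0 m y
    = (\sum_(m < N) (c m : k) *: u ^+ m) * y.
  by rewrite mulr_suml; apply: eq_bigr => m _; rewrite lriter_mull scalerAl.
by rewrite -mulrBl -[N]addn0; apply: valSM => //; rewrite addn0; apply: valS_compS.
Qed.

Lemma compS1 u : compS (1 : fps k^o) u = 1.
Proof. by rewrite compSE lrS1. Qed.

Lemma compSM c d u : valS 1 u -> compS (c * d) u = compS c u * compS d u.
Proof.
move=> u1; rewrite [LHS]compSE lrSM //.
by rewrite lrS_mull // -compSE.
Qed.

Lemma compSX c u m : valS 1 u -> compS (c ^+ m) u = compS c u ^+ m.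
Proof.
by move=> u1; elim: m => [|m IHm]; rewrite ?compS1 // !exprS compSM // IHm.
Qed.

Lemma compSD c d u : compS (c + d) u = compS c u + compS d u.
Proof.
apply/fpsP => n; rewrite coefsD !coefs_fps_sum -big_split.
by apply: eq_bigr => m _; rewrite !coefsZ scalerDl.
Qed.

Lemma compSZ (e : k) c u : compS (e *: c) u = e *: compS c u.
Proof.
apply/fpsP => n; rewrite coefsZ !coefs_fps_sum scaler_sumr.
by apply: eq_bigr => m _; rewrite !coefsZ scalerA.
Qed.

Lemma compS_sum (I : Type) (r : seq I) (P : pred I) (F : I -> fps k^o) u :
  compS (\sum_(i <- r | P i) F i) u = \sum_(i <- r | P i) compS (F i) u.
Proof.
elim/big_rec2: _ => [|i x y _ <-]; last by rewrite compSD.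
by rewrite -[0 : fps k^o](scale0r 0) compSZ scale0r.
Qed.

Lemma valS_compS_series N c u : valS 1 u -> valS N c -> valS N (compS c u).
Proof.
move=> u1 cN; apply: valS_fps_sum_ge => m.
have [/cN ->|leNm] := ltnP m N; first by rewrite scale0r.
by apply/valSZ/(valSW leNm)/valSX.
Qed.

(** Substituting u is an algebra morphism on scalar series, which settles the truncations of [c]; it
    also preserves order, which controls the remainder. *)
Lemma compSA (c : fps k^o) l u : valS 1 l -> valS 1 u ->
  compS c (compS l u) = compS (compS c l) u.
Proof.
move=> l1 u1; have lu1 : valS 1 (compS l u) by apply: valS_compS_series.
apply/esym/fps_sum_uniq => [m|N]; first exact: valS_compS_term.
have -> : \sum_(m < N) (c m : k) *: compS l u ^+ m
    = compS (\sum_(m < N) (c m : k) *: l ^+ m) u.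
  by rewrite compS_sum; apply: eq_bigr => m _; rewrite compSZ compSX.
rewrite -scaleN1r -compSZ -compSD scaleN1r.
by apply: valS_compS_series => //; apply: valS_fps_sum => m; apply/valSZ/valSX.
Qed.

Lemma compS_lamS u : valS 1 u -> compS (lamS (1 : k^o)) u = u.
Proof.
move=> u1; apply/esym/fps_sum_uniq => [m|N]; first exact: valS_compS_term.
case: N => [//|[|N]]; first by rewrite big_ord1 scale0r subr0.
rewrite !big_ord_recl scale0r scale1r add0r big1 ?addr0 ?subrr // => i _.
by rewrite scale0r.
Qed.

(** Constant terms cancel, and powers from the second on gain an order by [valSX_sub], so only the
    linear term of [c] is visible at order n. *)
Lemma valS_compS_sub (c : fps k^o) n f g : valS 1 f -> valS 1 g ->
  valS n (f - g) -> valS n.+1 (compS c f - compS c g - (c 1%N : k) *: (f - g)).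
Proof.
move=> f1 g1 fg; rewrite fps_sum_sub.
have um m : valS m ((c m : k) *: f ^+ m - (c m : k) *: g ^+ m).
  by apply: valSB; apply: valS_compS_term.
apply: valS_trans (valSW (leqnSn _) (@valS_fps_sum _ _ n.+2 um)) _.
rewrite !big_ord_recl !expr0 subrr add0r !expr1 -scalerBr addrAC subrr add0r.
apply: valS_big => i _; rewrite -scalerBr; apply: valSZ.
by apply: (@valSW _ _ (n + i.+1)); [rewrite addnS ltnS leq_addr|apply: valSX_sub].
Qed.

End Composition.

(** * Formal derivative and chain rule *)

Section Derivative.
Context (k : fieldType).
Implicit Types f g : fps k^o.

Definition derivS f : fps k^o := Fps (fun n => n.+1%:R * f n.+1).

Lemma fps_mulC f g : f * g = g * f.
Proof.
apply/fpsP => n; rewrite !coefsM (reindex_inj rev_ord_inj) /=.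
by apply: eq_bigr => i _; rewrite subSS subKn ?leq_ord // mulrC.
Qed.

Lemma coefsMlamS f n : (f * lamS 1) n.+1 = f n.
Proof.
rewrite coefsM big_ord_recr /= subnn mulr0 addr0 big_ord_recr /= subSn // subnn.
rewrite mulr1 big1 ?add0r // => i _.
by rewrite eqn_leq leq_subLR addn1 ltnS leqNgt (leq_trans (ltn_ord i)) ?mulr0.
Qed.

Lemma derivSM f g : derivS (f * g) = derivS f * g + f * derivS g.
Proof.
apply/fpsP => n; rewrite coefsD /= !coefsM mulr_sumr.
transitivity (\sum_(i < n.+2) (i%:R * (f i * g (n.+1 - i)%N)
    + f i * ((n.+1 - i)%:R * g (n.+1 - i)%N))).
  apply: eq_bigr => i _; rewrite -{1}(subnKC (leq_ord i)) natrD mulrDl.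
  by congr (_ + _); rewrite mulrCA.
rewrite big_split /=; congr (_ + _).
  rewrite big_ord_recl mul0r add0r; apply: eq_bigr => i _.
  by rewrite /= mulrA.
rewrite big_ord_recr /= subnn mul0r mulr0 addr0; apply: eq_bigr => i _.
by rewrite subSn // leq_ord.
Qed.

Lemma derivSX f m : derivS (f ^+ m.+1) = m.+1%:R *: (f ^+ m * derivS f).
Proof.
elim: m => [|m IHm]; first by rewrite expr0 mul1r scale1r.
rewrite exprS derivSM IHm -scalerAr mulrA -exprS fps_mulC -[m.+2]add1n natrD.
by rewrite scalerDl scale1r.
Qed.

Fact derivS_linear : linear derivS.
Proof.
move=> e f g; apply/fpsP => n; rewrite coefsD coefsZ /=.
change ((e *: f + g) n.+1) with (e *: f n.+1 + g n.+1).
by rewrite mulrDr -scalerAr.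
Qed.
HB.instance Definition _ :=
  GRing.isLinear.Build k (fps k^o) (fps k^o) _ derivS derivS_linear.

Lemma valS_derivS n f : valS n.+1 f -> valS n (derivS f).
Proof. by move=> fn i ltin; rewrite /= fn ?mulr0. Qed.

Lemma derivS_compS (c : fps k^o) f : valS 1 f ->
  derivS (compS c f) = compS (derivS c) f * derivS f.
Proof.
move=> f1; apply: valS_eq => n.
(* Differentiation loses one order, so agreement modulo lambda^n takes n.+1 terms of the series. *)
have := valS_derivS (@valS_compS _ _ c f n.+1 f1).
rewrite linearB /= => /valS_trans; apply.
have -> : derivS (\sum_(m < n.+1) (c m : k) *: f ^+ m)
    = (\sum_(m < n) (derivS c m : k) *: f ^+ m) * derivS f.
  rewrite linear_sum big_ord_recl /= linearZ /=.
  have -> : derivS (f ^+ 0) = 0.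
    by apply/fpsP => i; rewrite expr0 /= mulr0.
  rewrite scaler0 add0r mulr_suml; apply: eq_bigr => m _.
  rewrite linearZ /= derivSX scalerA -scalerAl; congr (_ *: _).
  by rewrite [RHS]mulrC.
rewrite -mulrBl -[n]addn0; apply: valSM => //; rewrite addn0.
exact/valSBC/valS_compS.
Qed.

End Derivative.

(** * Exponential, logarithm and BCH *)

Section ExpLog.
Context (k : fieldType) (char_k : [pchar k] =i pred0).

Lemma natrS_neq0 n : n.+1%:R != 0 :> k.
Proof. by rewrite (pcharf0P k).1. Qed.

Lemma fact_neq0 n : n`!%:R != 0 :> k.
Proof. by rewrite (pcharf0P k).1 // -lt0n fact_gt0. Qed.

Definition exp_coefs : fps k^o := Fps (fun m => m`!%:R^-1 : k).
Definition log_coefs : fps k^o :=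
  Fps (fun m => if m is m'.+1 then (-1) ^+ m' / m%:R : k else 0).

Lemma derivS_exp_coefs : derivS exp_coefs = exp_coefs.
Proof.
apply/fpsP => n; rewrite /= factS natrM invfM mulrA mulfV ?mul1r //.
exact: natrS_neq0.
Qed.

Lemma valS_log_coefs : valS 1 log_coefs.
Proof. by case. Qed.

Lemma derivS_log_coefs : derivS log_coefs * (1 + lamS 1) = 1.
Proof.
rewrite mulrDr mulr1; apply/fpsP => -[|n]; rewrite coefsD.
  by rewrite coefsM big_ord1 /= mulr0 addr0 expr0 !mul1r invr1.
rewrite coefsMlamS /= ![_ * (_ / _)]mulrC !divfK ?natrS_neq0 //.
by rewrite exprS mulN1r addNr.
Qed.

(* With G = exp(log(1 + z)), the chain rule gives (1 + z) G' = G. *)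
Lemma exp_log_coefs : compS exp_coefs log_coefs = 1 + lamS 1.
Proof.
set G := compS _ _.
have G0 : G 0%N = 1 by rewrite coefs0_compS /= fact0 invr1 scale1r.
have dG : derivS G * (1 + lamS 1) = G.
  rewrite derivS_compS ?derivS_exp_coefs; last exact: valS_log_coefs.
  by rewrite -mulrA derivS_log_coefs mulr1.
have G1 : G 1%N = 1.
  rewrite -G0 -{2}dG mulrDr mulr1 coefsD coefsM big_ord1 /= mulr0 addr0.
  by rewrite mul1r.
have recG n : n.+2%:R * G n.+2 + n.+1%:R * G n.+1 = G n.+1.
  by rewrite -[in RHS]dG mulrDr mulr1 coefsD coefsMlamS.
(* In [recG] at index 0 the two occurrences of [G 1] cancel, so G_2 = 0; each later coefficient is
   then a multiple of the previous one. *)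
have G2 n : G n.+2 = 0.
  elim: n => [|n IHn].
    have /eqP := recG 0%N; rewrite mul1r -subr_eq0 addrK mulf_eq0.
    by rewrite (negPf (natrS_neq0 _)) => /eqP.
  have /eqP := recG n.+1; rewrite IHn mulr0 addr0 mulf_eq0.
  by rewrite (negPf (natrS_neq0 _)) => /eqP.
apply/fpsP => -[|[|n]]; rewrite coefsD /= ?G0 ?G1 ?G2 ?addr0 ?add0r //.
Qed.

Context (A : algType k).
Implicit Types (a b f g x y : fps A).

Lemma expSE f : expS f = compS exp_coefs f.
Proof. by []. Qed.

Lemma logSE g : valS 1 (g - 1) -> logS g = compS log_coefs (g - 1).
Proof.
move=> g1; rewrite /compS fps_sum_recl ?scale0r ?add0r // => m.
exact: valS_compS_term.
Qed.

Lemma expS_logS g : valS 1 (g - 1) -> expS (logS g) = g.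
Proof.
move=> g1; rewrite logSE // expSE (compSA _ valS_log_coefs) // exp_log_coefs.
by rewrite compSD compS1 compS_lamS // addrC subrK.
Qed.

Lemma valS_expS1 f : valS 1 (expS f - 1).
Proof.
by move=> [|//] _; rewrite expSE coefsB coefs0_compS /= fact0 invr1 scale1r subrr.
Qed.

Lemma valS_expM1 x y : valS 1 (expS x * expS y - 1).
Proof.
rewrite -(subrKA (expS y)) -[X in _ - X]mul1r -mulrBl.
apply: valSD (valS_expS1 _); rewrite -[1%N]addn0.
by apply: valSM => //; apply: valS_expS1.
Qed.

Lemma valS_logS g : valS 1 (g - 1) -> valS 1 (logS g).
Proof.
by move=> g1; rewrite logSE // => -[|//] _; rewrite coefs0_compS scale0r.
Qed.

(* The m-th Cauchy product S_m = sum_i a^i / i! * b^(m-i) / (m-i)! satisfies         *)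
(* (m + 1) S_(m+1) = a S_m + S_m b, hence S_m = (lrmul a b)^m 1 / m!.                *)
Lemma lrS_exp a b : valS 1 a -> valS 1 b ->
  lrS exp_coefs a b 1 = expS a * expS b.
Proof.
move=> a1 b1.
pose e f i : fps A := (exp_coefs i : k) *: f ^+ i.
have eS f i : i.+1%:R *: e f i.+1 = f * e f i.
  rewrite scalerA -scalerAr -exprS; congr (_ *: _).
  by rewrite /= factS natrM invfM mulrA mulfV ?mul1r ?natrS_neq0.
have eC f i : e f i * f = f * e f i by rewrite -scalerAl -scalerAr -exprSr exprS.
pose S m := \sum_(i < m.+1) e a i * e b (m - i)%N.
have recS m : m.+1%:R *: S m.+1 = a * S m + S m * b.
  rewrite scaler_sumr; transitivity (\sum_(i < m.+2)
    ((i%:R *: e a i) * e b (m.+1 - i)%N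
     + e a i * ((m.+1 - i)%:R *: e b (m.+1 - i)%N))).
    apply: eq_bigr => i _; move: (e a i) (e b _) => u v.
    rewrite -scalerAl -scalerAr -scalerDl -natrD.
    by rewrite subnKC // leq_ord.
  rewrite big_split /=; congr (_ + _).
    rewrite big_ord_recl scale0r mul0r add0r mulr_sumr.
    by apply: eq_bigr => i _; rewrite eS mulrA.
  rewrite big_ord_recr /= subnn scale0r mulr0 addr0 mulr_suml.
  by apply: eq_bigr => i _; rewrite subSn ?leq_ord // eS -mulrA eC.
have SE m : S m = (exp_coefs m : k) *: lriter a b m 1.
  elim: m => [|m IHm].
    by rewrite /S big_ord1 /e /= !expr0 fact0 invr1 !scale1r mulr1.
  apply: (scalerI (natrS_neq0 m)); rewrite recS IHm scalerA.
  rewrite [m.+1%:R * _](_ : _ = exp_coefs m); last first.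
    by rewrite /= factS natrM invfM mulrA mulfV ?mul1r ?natrS_neq0.
  by rewrite lriterS -scalerAr -scalerAl -scalerDr.
apply/esym/fps_sum_uniq => [m|N]; first exact: valS_lrS_term.
under eq_bigr => m _ do rewrite -SE.
rewrite -(sum_triangle (fun i j => e a i * e b j)).
have tr f : valS 1 f -> valS N (expS f - \sum_(i < N) e f i).
  by move=> f1; exact: (@valS_compS _ _ exp_coefs f N f1).
(* The two exponentials are truncated in turn; what is left of the product of truncations consists
   of pairs with i + j >= N. *)
apply: (@valS_trans _ _ _ ((\sum_(i < N) e a i) * expS b)).
  by rewrite -mulrBl -[N]addn0; apply: valSM => //; rewrite addn0; apply: tr.
apply: (@valS_trans _ _ _ ((\sum_(i < N) e a i) * \sum_(j < N) e b j)).
  by rewrite -mulrBr -[N]add0n; apply: valSM => //; rewrite add0n; apply: tr.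
rewrite mulr_suml -sumrB; apply: valS_big => i _.
rewrite mulr_sumr (bigID (fun j : 'I_N => i + j < N)%N) /= addrAC subrr add0r.
apply: valS_big => j; rewrite -leqNgt => leN.
by apply: (valSW leN); apply: valSM; apply/valSZ/valSX.
Qed.

(** The linear part of log(exp x exp y) is x + y, which is exactly what [BCH] subtracts. The changes
    in exp, in the product and in log each equal their linear part up to order n.+1. *)
Lemma BCH_contr n x y x' y' :
  valS 1 x -> valS 1 y -> valS 1 x' -> valS 1 y' ->
  valS n (x - x') -> valS n (y - y') -> valS n.+1 (BCH x y - BCH x' y').
Proof.
move=> x1 y1 x1' y1' xx yy; rewrite /BCH.
set X := expS x; set Y := expS y; set X' := expS x'; set Y' := expS y'.
have tanE f f' : valS 1 f -> valS 1 f' -> valS n (f - f') ->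
    valS n.+1 ((expS f - expS f') - (f - f')).
  move=> f1 f1' ff; have := @valS_compS_sub _ _ exp_coefs n _ _ f1 f1' ff.
  by rewrite /= (factS 0) muln1 invr1 scale1r.
have difE f f' : valS 1 f -> valS 1 f' -> valS n (f - f') ->
    valS n (expS f - expS f').
  move=> f1 f1' ff; have := tanE _ _ f1 f1' ff.
  by move=> /(valSW (leqnSn _))/valSD/(_ ff); rewrite subrK.
(* The error is (X - X')(Y - 1) + (X' - 1)(Y - Y'), where exponentials minus 1 supply the extra
   order. *)
have prodE : valS n.+1 ((X * Y - X' * Y') - ((X - X') + (Y - Y'))).
  have -> : (X * Y - X' * Y') - ((X - X') + (Y - Y'))
      = (X - X') * (Y - 1) + (X' - 1) * (Y - Y').
    rewrite [RHS](_ : _ = (X - X') * Y + X' * (Y - Y') - ((X - X') + (Y - Y'))).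
      by congr (_ - _); rewrite mulrBl mulrBr subrKA.
    rewrite [(X - X') * (Y - 1)]mulrBr mulr1 [(X' - 1) * _]mulrBl mul1r.
    by rewrite addrACA -opprD.
  apply: valSD; first by rewrite -addn1; apply: valSM (valS_expS1 _); apply: difE.
  by rewrite -add1n; apply: valSM (valS_expS1 _) _; apply: difE.
have P1 := valS_expM1 x y; have P1' := valS_expM1 x' y'.
have PP : (X * Y - 1) - (X' * Y' - 1) = X * Y - X' * Y'.
  by rewrite subrACA subrr subr0.
have sumE : valS n.+1 ((X * Y - X' * Y') - ((x - x') + (y - y'))).
  apply: valS_trans prodE _; rewrite opprD addrACA.
  by apply: valSD; apply: tanE.
have logE : valS n.+1 (logS (X * Y) - logS (X' * Y') - (X * Y - X' * Y')).
  rewrite !logSE // -PP; have := @valS_compS_sub _ _ log_coefs n _ _ P1 P1'.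
  rewrite /= expr0 divr1 scale1r PP; apply.
  have := valSD (valSW (leqnSn _) sumE) (valSD xx yy).
  by rewrite subrK.
rewrite subrACA [X in X - _]subrACA -addrA -opprD.
exact: valS_trans logE sumE.
Qed.

End ExpLog.

(** * Generating function of the Bernoulli numbers *)

Section Bernoulli.
Context (k : fieldType) (char_k : [pchar k] =i pred0).

Lemma size_bernoulli_seq m : size (bernoulli_seq k m) = m.+1.
Proof. by elim: m => //= m IHm; rewrite size_rcons IHm. Qed.

Lemma nth_bernoulli_seq m j : (j <= m)%N -> (bernoulli_seq k m)`_j = bernoulli k j.
Proof.
elim: m => [|m IHm]; first by rewrite leqn0 => /eqP ->.
rewrite leq_eqVlt => /predU1P[-> //|ltjm].
by rewrite /= nth_rcons size_bernoulli_seq ltjm IHm.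
Qed.

Lemma bernoulliS m : bernoulli k m.+1 =
  - m.+2%:R^-1 * \sum_(j < m.+1) 'C(m.+2, j)%:R * bernoulli k j.
Proof.
rewrite {1}/bernoulli /= nth_rcons size_bernoulli_seq ltnn eqxx.
congr (_ * _); apply: eq_bigr => j _; rewrite nth_bernoulli_seq //.
by rewrite -ltnS.
Qed.

(** The definition of [bernoulli] solves this relation for its top term, whose binomial coefficient
    is m + 1. *)
Lemma sum_bin_bernoulli m :
  \sum_(j < m.+1) 'C(m.+1, j)%:R * bernoulli k j = (m == 0)%:R.
Proof.
case: m => [|m]; first by rewrite big_ord1 bin0 mul1r.
rewrite big_ord_recr /= binSn bernoulliS mulrA mulrN mulfV ?natrS_neq0 //.
by rewrite mulN1r subrr.
Qed.

Definition bernoulli_coefs : fps k^o := Fps (fun m => bernoulli k m / m`!%:R).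

(* (e^z - 1) / z *)
Definition expm1_coefs : fps k^o := Fps (fun m => m.+1`!%:R^-1 : k).

Lemma bernoulli_coefsM : bernoulli_coefs * expm1_coefs = 1.
Proof.
have cancel (c b p q : k) : p != 0 -> q != 0 -> c * (p * q) * (b / p * q^-1) = c * b.
  move=> p0 q0; rewrite -mulrA mulrACA mulfV // mulr1 [p * _]mulrCA mulfV //.
  by rewrite mulr1.
apply/fpsP => n; rewrite coefsM coefs1.
(* Scaling by (n+1)! turns the product of B_j / j! and 1 / (n+1-j)! into a binomial coefficient
   times B_j. *)
apply: (mulfI (fact_neq0 char_k n.+1)); rewrite mulr_sumr.
transitivity (\sum_(j < n.+1) 'C(n.+1, j)%:R * bernoulli k j).
  apply: eq_bigr => j _; have lejn : (j <= n.+1)%N by apply/leqW/leq_ord.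
  rewrite -(bin_fact lejn) !natrM /= -subSn ?leq_ord //.
  by apply: cancel; apply: fact_neq0.
by case: n => [|n]; [rewrite mulr1|rewrite mulr0]; apply: sum_bin_bernoulli.
Qed.

End Bernoulli.

(** * The Magnus recursion and the BCH recursion *)

Section MagnusChi.
Context (k : fieldType) (char_k : [pchar k] =i pred0).
Context (theta : k) (theta_neq0 : theta != 0).
Context (A : algType k) (R : {linear A -> A}).
Implicit Types (x y w alpha : fps A).

Local Notation Rt := (RB_tilde theta R).
Local Notation rb w := (fps_map R w).
Local Notation rbt w := (fps_map Rt w).

Fact RB_tilde_linear : linear Rt.
Proof.
move=> c x y; rewrite /RB_tilde linearP opprD scalerDr addrACA scalerBr.
by rewrite !scalerA mulrC.
Qed.
HB.instance Definition _ := GRing.isLinear.Build k A A _ Rt RB_tilde_linear.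

Lemma valS_map (h : {linear A -> A}) n x : valS n x -> valS n (fps_map h x).
Proof. by move=> xn i ltin; rewrite /= xn ?linear0. Qed.

Lemma valS_map_sub (h : {linear A -> A}) n x y :
  valS n (x - y) -> valS n (fps_map h x - fps_map h y).
Proof.
move=> /valSB_eq xy; apply/valSB_eq => i ltin.
by rewrite /= xy.
Qed.

Lemma fps_map_RB w : rb w + rbt w = - theta *: w.
Proof. by apply/fpsP => n; rewrite coefsD /= /RB_tilde addrC subrK. Qed.

(** The terms - y R(x) - theta y x combine to y R~(x). The convolution for right multiplication runs
    in reverse order, hence the reindexing. *)
Lemma L_prelieE w y : L_prelie theta R w y = lrmul (rb w) (rbt w) y.
Proof.
apply/fpsP => n; rewrite coefs_bilin coefsD !coefsM.
rewrite [X in _ + X](reindex_inj rev_ord_inj) -big_split; apply: eq_bigr => i _.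
rewrite /= subSS subKn ?leq_ord // /prelie /RB_tilde -addrA mulrBr.
by rewrite -scalerAr scaleNr [- _ - _]addrC.
Qed.

Lemma Omega_recE x w :
  Omega_rec theta R x w = lrS (bernoulli_coefs k) (rb w) (rbt w) x.
Proof.
congr fps_sum; apply/funext => m; congr (_ *: _).
by apply: eq_iter => y; apply: L_prelieE.
Qed.

Lemma valS_Omega_rec x w : valS 1 x -> valS 1 w -> valS 1 (Omega_rec theta R x w).
Proof.
move=> x1 w1; rewrite Omega_recE; apply: valS_fps_sum_ge => m; apply: valSZ.
apply: (@valSW _ _ (m + 1)); first by rewrite leq_addl.
by apply: valS_lriter => //; apply: valS_map.
Qed.

(** Changing one operator in the composite gives order n, and it acts on an element of order at
    least 1 because x has no constant term; this is where the contraction gains its order. *)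
Lemma valS_lriter_sub n m a b a' b' x : valS 1 x ->
  valS 1 a -> valS 1 b -> valS 1 a' -> valS 1 b' ->
  valS n (a - a') -> valS n (b - b') ->
  valS n.+1 (lriter a b m x - lriter a' b' m x).
Proof.
move=> x1 a1 b1 a1' b1' aa bb; elim: m => [|m IHm]; first by rewrite subrr.
rewrite !lriterS -(subrKA (lrmul a b (lriter a' b' m x))).
apply: valSD; first by rewrite -linearB; apply: valSW (valS_lrmul a1 b1 IHm).
have -> : forall y, lrmul a b y - lrmul a' b' y = lrmul (a - a') (b - b') y.
  by move=> y; rewrite /lrmul mulrBl mulrBr opprD addrACA.
rewrite -addn1; apply: valS_lrmul => //; apply: (@valSW _ _ (m + 1)).
  by rewrite leq_addl.
exact: valS_lriter.
Qed.

Lemma Omega_rec_contr x n w w' : valS 1 x -> valS 1 w -> valS 1 w' ->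
  valS n (w - w') -> valS n.+1 (Omega_rec theta R x w - Omega_rec theta R x w').
Proof.
move=> x1 w1 w1' ww; rewrite !Omega_recE fps_sum_sub.
apply: valS_fps_sum_ge => m; rewrite -scalerBr; apply: valSZ.
by apply: valS_lriter_sub => //; do ?[exact: valS_map|exact: valS_map_sub].
Qed.

Lemma Omega_uniq x w : valS 1 x -> valS 1 w -> Omega_rec theta R x w = w ->
  w = Omega theta R x.
Proof.
move=> x1; apply: fps_fix_uniq => [f|n f g]; first exact: valS_Omega_rec.
exact: Omega_rec_contr.
Qed.

Lemma chi_spec alpha : valS 1 alpha ->
  valS 1 (chi theta R alpha)
  /\ chi_rec theta R alpha (chi theta R alpha) = chi theta R alpha.
Proof.
move=> alpha1.
have lam f : valS 1 f -> valS 1 (chi_rec theta R alpha f).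
  move=> f1; apply/valSD/valSZ => //; do 2?apply: valSB.
  - by apply: valS_logS => //; apply: valS_expM1.
  - exact: valS_map.
  - exact: valS_map.
have contr n f g : valS 1 f -> valS 1 g -> valS n (f - g) ->
    valS n.+1 (chi_rec theta R alpha f - chi_rec theta R alpha g).
  move=> f1 g1 fg; rewrite /chi_rec opprD addrACA subrr add0r -scalerBr.
  by apply: valSZ; apply: BCH_contr => //; do ?[exact: valS_map|exact: valS_map_sub].
by split; [apply: valS1_fps_fix|apply: fps_fix_spec].
Qed.

(** Since R(w) + R~(w) = - theta w, the terms subtracted in [BCH] contribute exactly w to the right
    side of the recursion. Cancelling w leaves log(exp(R w) exp(R~ w)) = - theta alpha. *)
Lemma expS_chi alpha : valS 1 alpha ->
  let w := chi theta R alpha in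
  expS (rb w) * expS (rbt w) = expS (- theta *: alpha).
Proof.
move=> alpha1 w; have [w1 wE] := chi_spec alpha1.
rewrite -[LHS]expS_logS //; last exact: valS_expM1.
congr expS; move: wE; rewrite /chi_rec /BCH -addrA -opprD fps_map_RB -/w.
rewrite scalerBr scaleNr scalerN scalerA mulVf // scale1r opprK addrA.
move=> /(canRL (addrK w))/eqP; rewrite subrr addr_eq0 => /eqP ->.
by rewrite scaleNr scalerN opprK scalerA mulfV // scale1r.
Qed.

Lemma chi_Omega alpha : valS 1 alpha ->
  chi theta R alpha = Omega theta R (theta^-1 *: (1 - expS (- theta *: alpha))).
Proof.
move=> alpha1; have [w1 _] := chi_spec alpha1; have := expS_chi alpha1.
set w := chi theta R alpha in w1 *; move=> /= <-.
have [a1 b1] := (valS_map R w1, @valS_map Rt _ _ w1).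
apply: Omega_uniq => //.
  by apply/valSZ/valSBC/valS_expM1.
(* Splitting off the constant term of exp(L_w)(1) and using L_w(1) = - theta w leaves x as (e^z - 1)
   / z at L_w, applied to w. *)
rewrite -(lrS_exp char_k) // lrS_recl // opprD addrA.
have -> : ((exp_coefs k 0%N : k) *: 1 : fps A) = 1.
  by rewrite /= fact0 invr1 scale1r.
rewrite subrr add0r {1}/lrmul mulr1 mul1r fps_map_RB lrSZ.
rewrite scaleNr opprK scalerA mulVf // scale1r Omega_recE -lrSM //.
by rewrite bernoulli_coefsM // lrS1.
Qed.

End MagnusChi.

Theorem mainTheorem6 (k : fieldType) (char_k : [pchar k] =i pred0)
    (theta : k) (theta_neq0 : theta != 0)
    (A : algType k) (R : {linear A -> A}) (RB_R : rota_baxter theta R) :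
  (forall a : A,
     Omega theta R (lamS a)
     = chi theta R (- (theta^-1 *: logS (1 - theta *: lamS a))))
  /\
  (forall alpha : fps A, in_lamS alpha ->
     chi theta R alpha
     = Omega theta R (theta^-1 *: (1 - expS (- theta *: alpha)))).
Proof.
split=> [a|alpha /in_lamSE alpha1]; last exact: chi_Omega.
have a1 : valS 1 (1 - theta *: lamS a - 1).
  by rewrite addrAC subrr add0r; apply/valSN/valSZ => -[].
(* For this alpha, exp(- theta alpha) = 1 - theta lambda a, so the argument of [Omega] collapses to
   lambda a. *)
rewrite chi_Omega //; last by apply/valSN/valSZ/valS_logS.
rewrite scaleNr scalerN opprK scalerA mulfV // scale1r expS_logS //.
by rewrite opprB addrC subrK scalerA mulVf // scale1r.
Qed.
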